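(* Let $n\ge 1$, let $\lambda=(\lambda_1,\dots,\lambda_n)\in\mathbb{R}^n$ with $0<\lambda_1\le\dots\le\lambda_n$, and let $\Delta$ be a local $\frac12$-derivation of the oscillator Lie algebra $\mathfrak{L}_\lambda$. Then there are complex numbers $d_{-1},d_0,\dots,d_{2n}$, $a_0,a_1,\dots,a_n$, $c_1,\dots,c_n$ and $b$ such that $$\Delta(e_{-1})=\sum_{j=-1}^{n}d_je_j+\sum_{j=1}^{n}d_{n+j}\check{e}_j,\qquad \Delta(e_0)=a_0e_0,$$ $$\Delta(e_i)=a_ie_0+b\,e_i,\qquad \Delta(\check{e}_i)=c_ie_0+b\,\check{e}_i\qquad(1\le i\le n).$$
   Context: All algebras are over $\mathbb{C}$. A linear map $D:\mathfrak{L}\to\mathfrak{L}$ on a Lie algebra is a $\frac12$-derivation if $D[x,y]=\frac12\big([D(x),y]+[x,D(y)]\big)$ for all $x,y\in\mathfrak{L}$. A linear map $\Delta:\mathfrak{L}\to\mathfrak{L}$ is a local $\frac12$-derivation if for every $x\in\mathfrak{L}$ there is a $\frac12$-derivation $D_x$ (depending on $x$) with $\Delta(x)=D_x(x)$. The oscillator Lie algebra $\mathfrak{L}_\lambda$ is the $(2n+2)$-dimensional Lie algebra with basis $\{e_{-1},e_0,e_j,\check{e}_j\}_{j=1,\dots,n}$ and brackets $[e_{-1},e_j]=\lambda_j\check{e}_j$, $[e_{-1},\check{e}_j]=-\lambda_je_j$, $[e_j,\check{e}_j]=e_0$ for $j=1,\dots,n$; brackets of basis elements not obtained from these by antisymmetry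 are zero. *)

(* Defs.v *)
From HB Require Import structures.
From mathcomp Require Import all_boot all_algebra.
From mathcomp Require Import ring.

Set Implicit Arguments.
Unset Strict Implicit.
Unset Printing Implicit Defensive.

Import GRing.Theory.
Local Open Scope ring_scope.

HB.mixin Record Lmodule_isLie (K : fieldType) L of GRing.Lmodule K L := {
  lie : L -> L -> L;
  lie_linearl : forall y (a : K) x x',
    lie (a *: x + x') y = a *: lie x y + lie x' y;
  lie_linearr : forall x (a : K) y y',
    lie x (a *: y + y') = a *: lie x y + lie x y';
  lie_alt : forall x, lie x x = 0;
  lie_jacobi : forall x y z,
    lie x (lie y z) + lie y (lie z x) + lie z (lie x y) = 0
}.

#[short(type="lieAlgType")]
HB.structure Definition LieAlgebra (K : fieldType) :=
  { L of Lmodule_isLie K L & GRing.Lmodule K L }.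

Definition half_derivation (K : fieldType) (L : lieAlgType K)
    (D : {linear L -> L}) : Prop :=
  forall x y : L, D (lie x y) = 2^-1 *: (lie (D x) y + lie x (D y)).

Definition local_half_derivation (K : fieldType) (L : lieAlgType K)
    (Delta : {linear L -> L}) : Prop :=
  forall x : L, exists2 D : {linear L -> L}, half_derivation D & Delta x = D x.

(* Labels of the basis vectors e_{-1}, e_0, e_j and \check{e}_j, with j
   numbered from 0. *)
Inductive osc_index (n : nat) : Type :=
  | IdxM1 | Idx0 | IdxE of 'I_n | IdxEc of 'I_n.
Arguments IdxM1 {n}.
Arguments Idx0 {n}.

Definition osc_index_code n (i : osc_index n) : bool + ('I_n + 'I_n) :=
  match i with
  | IdxM1 => inl true
  | Idx0 => inl false
  | IdxE j => inr (inl j)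
  | IdxEc j => inr (inr j)
  end.

Definition osc_index_decode n (s : bool + ('I_n + 'I_n)) : osc_index n :=
  match s with
  | inl true => IdxM1
  | inl false => Idx0
  | inr (inl j) => IdxE j
  | inr (inr j) => IdxEc j
  end.

Lemma osc_index_codeK n : cancel (@osc_index_code n) (@osc_index_decode n).
Proof. by case. Qed.

HB.instance Definition _ n :=
  Finite.copy (osc_index n) (can_type (@osc_index_codeK n)).

(* Over K := C with real weights this is the usual oscillator Lie algebra.
   The underlying space does not depend on lam; the parameter only selects the
   Lie algebra structure found by inference. *)
Definition oscillator (K : fieldType) (n : nat) (lam : 'I_n -> K) : Type :=
  {ffun osc_index n -> K^o}.

HB.instance Definition _ (K : fieldType) (n : nat) (lam : 'I_n -> K) :=
  GRing.Lmodule.on (oscillator lam).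

Section Oscillator.
Variables (K : fieldType) (n : nat) (lam : 'I_n -> K).
Local Notation L := (oscillator lam).

Definition osc_basis (i : osc_index n) : L := [ffun k => (k == i)%:R].

Definition osc_em1 : L := osc_basis IdxM1.
Definition osc_e0 : L := osc_basis Idx0.
Definition osc_e (j : 'I_n) : L := osc_basis (IdxE j).
Definition osc_ec (j : 'I_n) : L := osc_basis (IdxEc j).

Definition osc_table (i j : osc_index n) : L :=
  match i, j with
  | IdxM1, IdxE k => lam k *: osc_ec k
  | IdxE k, IdxM1 => - (lam k *: osc_ec k)
  | IdxM1, IdxEc k => - (lam k *: osc_e k)
  | IdxEc k, IdxM1 => lam k *: osc_e k
  | IdxE k, IdxEc l => if k == l then osc_e0 else 0
  | IdxEc k, IdxE l => if k == l then - osc_e0 else 0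
  | _, _ => 0
  end.

Definition osc_lie (x y : L) : L :=
  \sum_i \sum_j (x i * y j) *: osc_table i j.

Lemma osc_sumE (V : nmodType) (F : osc_index n -> V) :
  \sum_i F i = F IdxM1 + F Idx0 + \sum_j F (IdxE j) + \sum_j F (IdxEc j).
Proof.
rewrite (reindex (@osc_index_decode n)) /=; last first.
  exists (@osc_index_code n) => i _; last exact: osc_index_codeK.
  by case: i => [[]|[]].
by rewrite big_sumType big_bool /= big_sumType /= addrA.
Qed.

Lemma osc_basis_expand (x : L) : x = \sum_i x i *: osc_basis i.
Proof.
apply/ffunP => k; rewrite sum_ffunE (bigD1 k) //= !ffunE eqxx.
rewrite big1 => [|i /negPf ik]; first by rewrite addr0 /GRing.scale /= mulr1.
by rewrite !ffunE eq_sym ik scaler0.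
Qed.

Lemma osc_lie_basis i j : osc_lie (osc_basis i) (osc_basis j) = osc_table i j.
Proof.
rewrite /osc_lie (bigD1 i) //= (bigD1 j) //= !ffunE !eqxx mulr1 scale1r.
rewrite !big1 ?addr0 // => [k /negPf ki|k /negPf kj].
  by apply: big1 => l _; rewrite !ffunE ki mul0r scale0r.
by rewrite !ffunE kj mulr0 scale0r.
Qed.

Lemma osc_lieE x y k : osc_lie x y k =
  match k with
  | IdxM1 => 0
  | Idx0 => \sum_j (x (IdxE j) * y (IdxEc j) - x (IdxEc j) * y (IdxE j))
  | IdxE j => lam j * (x (IdxEc j) * y IdxM1 - x IdxM1 * y (IdxEc j))
  | IdxEc j => lam j * (x IdxM1 * y (IdxE j) - x (IdxE j) * y IdxM1)
  end.
Proof.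
have idxE_inj : injective (@IdxE n) by move=> ? ? [].
have idxEc_inj : injective (@IdxEc n) by move=> ? ? [].
have -> : osc_lie x y k = \sum_i \sum_j x i * y j * osc_table i j k.
  rewrite /osc_lie sum_ffunE; apply: eq_bigr => i _.
  by rewrite sum_ffunE; apply: eq_bigr => j _; rewrite ffunE.
have tabE i j : osc_table (IdxE i) (IdxEc j) k
              = (i == j)%:R * (k == Idx0)%:R.
  by rewrite /=; case: eqP => _; rewrite !ffunE ?mul1r ?mul0r.
have tabEc i j : osc_table (IdxEc i) (IdxE j) k
               = - ((i == j)%:R * (k == Idx0)%:R).
  by rewrite /=; case: eqP => _; rewrite !ffunE ?mul1r ?mul0r ?oppr0.
have delta (F : 'I_n -> K) i (c : K) :
    \sum_j F j * ((i == j)%:R * c) = F i * c.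
  rewrite (bigD1 i) //= eqxx mul1r big1 ?addr0 // => j /negPf ji.
  by rewrite eq_sym ji mul0r mulr0.
have zero (F : 'I_n -> K) : \sum_j F j * (0 : L) k = 0.
  by apply: big1 => j _; rewrite ffunE mulr0.
have -> : \sum_i \sum_j x i * y j * osc_table i j k =
    \sum_j x IdxM1 * y (IdxE j) * (lam j * (k == IdxEc j)%:R)
  + \sum_j x IdxM1 * y (IdxEc j) * - (lam j * (k == IdxE j)%:R)
  + \sum_i (- (x (IdxE i) * y IdxM1 * (lam i * (k == IdxEc i)%:R))
            + x (IdxE i) * y (IdxEc i) * (k == Idx0)%:R)
  + \sum_i (x (IdxEc i) * y IdxM1 * (lam i * (k == IdxE i)%:R)
            - x (IdxEc i) * y (IdxE i) * (k == Idx0)%:R).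
  rewrite osc_sumE; congr (_ + _ + _).
  - rewrite (osc_sumE (fun j => x IdxM1 * _ * _)).
    rewrite (osc_sumE (fun j => x Idx0 * _ * _)).
    rewrite /= !zero !ffunE !mulr0 !add0r !addr0.
    by congr (_ + _); apply: eq_bigr => j _; rewrite !ffunE.
  - apply: eq_bigr => i _; rewrite osc_sumE.
    under [X in _ + X]eq_bigr => j _ do rewrite tabE.
    by rewrite (delta (fun j => _ * y (IdxEc j))) /= zero
               !ffunE mulr0 !addr0 mulrN.
  - apply: eq_bigr => i _; rewrite osc_sumE.
    under [X in _ + X + _]eq_bigr => j _ do rewrite tabEc mulrN.
    by rewrite sumrN (delta (fun j => _ * y (IdxE j))) /= zero
               !ffunE mulr0 !addr0.
have pick (F : 'I_n -> K) j (f : 'I_n -> osc_index n) : injective f ->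
    \sum_i F i * (f j == f i)%:R = F j.
  move=> finj; rewrite (bigD1 j) //= eqxx mulr1 big1 ?addr0 // => i /negPf ij.
  by rewrite (inj_eq finj) eq_sym ij mulr0.
case: k {tabE tabEc zero} => [| |j|j].
- by rewrite !big1 ?addr0 // => i _; rewrite !(mulr0, oppr0, addr0).
- rewrite big1 ?add0r => [|i _]; last by rewrite !mulr0.
  rewrite big1 ?add0r => [|i _]; last by rewrite !(mulr0, oppr0).
  rewrite -big_split; apply: eq_bigr => i _ /=.
  by rewrite !mulr0 !mulr1 oppr0 !add0r.
- rewrite big1 ?add0r => [|i _]; last by rewrite !mulr0.
  rewrite addrAC [X in _ + X]big1 ?addr0 => [|i _]; last first.
    by rewrite !(mulr0, oppr0, addr0).
  under eq_bigr => i _ do rewrite mulrN mulrA -mulNr.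
  rewrite pick //.
  under eq_bigr => i _ do rewrite mulr0 subr0 mulrA.
  by rewrite pick //; ring.
- rewrite [X in _ + X + _ + _]big1 ?addr0 => [|i _]; last first.
    by rewrite !(mulr0, oppr0, addr0).
  rewrite [X in _ + _ + X]big1 ?addr0 => [|i _]; last first.
    by rewrite !(mulr0, oppr0, addr0).
  under eq_bigr => i _ do rewrite mulrA.
  rewrite pick //.
  under eq_bigr => i _ do rewrite mulr0 addr0 mulrA -mulNr.
  by rewrite pick //; ring.
Qed.

Lemma osc_lie_linearl y (a : K) x x' :
  osc_lie (a *: x + x') y = a *: osc_lie x y + osc_lie x' y.
Proof.
rewrite /osc_lie scaler_sumr -big_split; apply: eq_bigr => i _ /=.
rewrite scaler_sumr -big_split; apply: eq_bigr => j _ /=.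
by rewrite !ffunE scalerA -scalerDl mulrDl mulrA.
Qed.

Lemma osc_lie_linearr x (a : K) y y' :
  osc_lie x (a *: y + y') = a *: osc_lie x y + osc_lie x y'.
Proof.
rewrite /osc_lie scaler_sumr -big_split; apply: eq_bigr => i _ /=.
rewrite scaler_sumr -big_split; apply: eq_bigr => j _ /=.
by rewrite !ffunE scalerA -scalerDl mulrDr mulrCA.
Qed.

Lemma osc_lie_alt x : osc_lie x x = 0.
Proof.
apply/ffunP => k; rewrite osc_lieE ffunE; case: k => [| |j|j] //=.
- by apply: big1 => j _; rewrite mulrC subrr.
- by rewrite mulrC [x _ * x _]mulrC subrr mul0r.
- by rewrite [x _ * x _]mulrC subrr mulr0.
Qed.

Lemma osc_lie_jacobi x y z :
  osc_lie x (osc_lie y z) + osc_lie y (osc_lie z x)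
  + osc_lie z (osc_lie x y) = 0.
Proof.
apply/ffunP => k; rewrite 3!ffunE !osc_lieE.
case: k => [| |j|j]; first by rewrite !addr0.
- rewrite -!big_split; apply: big1 => j _ /=; rewrite !osc_lieE; ring.
- rewrite !osc_lieE; ring.
- rewrite !osc_lieE; ring.
Qed.

HB.instance Definition _ := Lmodule_isLie.Build K L
  osc_lie_linearl osc_lie_linearr osc_lie_alt osc_lie_jacobi.

End Oscillator.

Arguments osc_em1 {K n lam}.
Arguments osc_e0 {K n lam}.
Arguments osc_e {K n lam} j.
Arguments osc_ec {K n lam} j.

(* Main.v *)
Require Import Defs.
From mathcomp Require Import all_boot all_order all_algebra.
From mathcomp Require Import reals complex.
From mathcomp Require Import ring.

Set Implicit Arguments.
Unset Strict Implicit.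

Import Order.TTheory GRing.Theory Num.Theory.
Local Open Scope ring_scope.
Local Open Scope complex_scope.

(** The heart of the matter is that, modulo the centre, a half-derivation D of
    the oscillator algebra acts on the hyperplane spanned by e_0, the e_j and
    the \check{e}_j as a single scalar, namely the coefficient alpha of e_{-1}
    in D(e_{-1}) ([half_derivation_scalar]).  To see this:
    - the coefficient of e_{-1} in any bracket vanishes, and every e_j and
      \check{e}_j is a multiple of a bracket with e_{-1}
      ([half_derivation_em1_coord]);
    - applying D to [e_{-1}, e_j] and [e_{-1}, \check{e}_j] relates the
      coordinates of D(e_j) to those of D(\check{e}_j)
      ([half_derivation_rotation]).  Up to a term in alpha, these relations say
      that the component of D from the (e_j, \check{e}_j) plane to the
      (e_k, \check{e}_k) plane intertwines the rotation of speed 2 lam_j with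
      that of speed lam_k.
      For k = j this forces the component to be alpha times the identity
      ([half_derivation_diag]), but for k <> j it leaves freedom in the resonant
      case lam_k = 2 lam_j;
    - applying D to the vanishing brackets of indices j <> k ties the (j, k)
      and the (k, j) coefficients together ([half_derivation_commutation]),
      and the two systems combined have only the zero solution, whatever the
      nonzero weights are ([half_derivation_offdiag]).

    A local half-derivation Delta therefore multiplies each vector x of the
    hyperplane by a scalar, modulo the centre, and this scalar might depend on
    x.  Comparing each e_j and \check{e}_j with the sum of all of them, whose
    coordinates along them are all equal to 1, shows that the scalar is the
    same for all these basis vectors ([local_half_derivation_basis]).  Finally
    Delta(e_0) is central because half-derivations preserve the centre. *)

(** * Half-derivations of a Lie algebra *)

Section HalfDerivation.
Variables (K : fieldType) (L : lieAlgType K).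

Lemma half_derivation_double (D : {linear L -> L}) (x y : L) :
  (2 : K) != 0 -> half_derivation D ->
  2 *: D (lie x y) = lie (D x) y + lie x (D y).
Proof. by move=> two_neq0 hD; rewrite hD scalerA divff // scale1r. Qed.

Lemma half_derivation_center (D : {linear L -> L}) (z : L) :
    (2 : K) != 0 -> half_derivation D ->
  (forall y, lie z y = 0) -> forall y, lie (D z) y = 0.
Proof.
move=> two_neq0 hD zC y; have := half_derivation_double z y two_neq0 hD.
by rewrite !zC linear0 scaler0 addr0.
Qed.

End HalfDerivation.

(** * Coordinates in the oscillator algebra *)

Section Oscillator.
Variables (K : fieldType) (n : nat) (lam : 'I_n -> K).
Local Notation L := (oscillator lam).
Local Notation em1 := (@osc_em1 K n lam).
Local Notation e0 := (@osc_e0 K n lam).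
Local Notation e := (@osc_e K n lam).
Local Notation ec := (@osc_ec K n lam).
Implicit Types (x y : L) (j k : 'I_n) (D : {linear L -> L}).

Lemma osc_bracketE x y i : lie x y i =
  match i with
  | IdxM1 => 0
  | Idx0 => \sum_j (x (IdxE j) * y (IdxEc j) - x (IdxEc j) * y (IdxE j))
  | IdxE j => lam j * (x (IdxEc j) * y IdxM1 - x IdxM1 * y (IdxEc j))
  | IdxEc j => lam j * (x IdxM1 * y (IdxE j) - x (IdxE j) * y IdxM1)
  end.
Proof. exact: osc_lieE. Qed.

Lemma osc_bracket_basis (i i' : osc_index n) :
  lie (osc_basis lam i) (osc_basis lam i') = osc_table lam i i'.
Proof. exact: osc_lie_basis. Qed.

Lemma osc_basisE (i i' : osc_index n) : osc_basis lam i i' = (i' == i)%:R.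
Proof. by rewrite ffunE. Qed.

Lemma osc_addE x y i : (x + y) i = x i + y i.
Proof. by rewrite ffunE. Qed.

Lemma osc_scaleE (a : K) x i : (a *: x) i = a * x i.
Proof. by rewrite ffunE. Qed.

Lemma osc_sum_coordE (I : finType) (F : I -> L) i :
  (\sum_s F s) i = \sum_s F s i.
Proof. by rewrite sum_ffunE. Qed.

Lemma eq_IdxE j k : (IdxE j == IdxE k) = (j == k).
Proof. by []. Qed.

Lemma eq_IdxEc j k : (IdxEc j == IdxEc k) = (j == k).
Proof. by []. Qed.

Definition osc_coordE := (osc_bracketE, osc_basisE, eq_IdxE, eq_IdxEc).

Lemma osc_expand x :
  x = x IdxM1 *: em1 + x Idx0 *: e0
      + \sum_j x (IdxE j) *: e j + \sum_j x (IdxEc j) *: ec j.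
Proof. by rewrite {1}[x]osc_basis_expand osc_sumE. Qed.

Lemma sum_pick (F : 'I_n -> K) j : \sum_k F k * (k == j)%:R = F j.
Proof.
rewrite (bigD1 j) //= eqxx mulr1 big1 ?addr0 // => k /negPf ->.
by rewrite mulr0.
Qed.

Lemma sum_pickl (F : 'I_n -> K) j : \sum_k (k == j)%:R * F k = F j.
Proof. by under eq_bigr do rewrite mulrC; exact: sum_pick. Qed.

Lemma osc_bracket_em1_coord x j :
  (lie em1 x (IdxE j) = - (lam j * x (IdxEc j)))
  * (lie em1 x (IdxEc j) = lam j * x (IdxE j)).
Proof. by rewrite !osc_coordE /=; split; ring. Qed.

Lemma osc_bracket_e_e0coord x j :
  (lie x (e j) Idx0 = - x (IdxEc j)) * (lie (e j) x Idx0 = x (IdxEc j)).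
Proof.
rewrite !osc_bracketE; split.
  under eq_bigr do rewrite !osc_coordE mulr0 sub0r.
  by rewrite sumrN sum_pick.
under eq_bigr do rewrite !osc_coordE mul0r subr0.
by rewrite sum_pickl.
Qed.

Lemma osc_bracket_ec_e0coord x j :
  (lie x (ec j) Idx0 = x (IdxE j)) * (lie (ec j) x Idx0 = - x (IdxE j)).
Proof.
rewrite !osc_bracketE; split.
  under eq_bigr do rewrite !osc_coordE mulr0 subr0.
  by rewrite sum_pick.
under eq_bigr do rewrite !osc_coordE mul0r sub0r.
by rewrite sumrN sum_pickl.
Qed.

Hypothesis lam_neq0 : forall j, lam j != 0.

Lemma osc_em1_bracket_e j : lie em1 (e j) = lam j *: ec j :> L.
Proof. exact: osc_bracket_basis. Qed.

Lemma osc_em1_bracket_ec j : lie em1 (ec j) = - (lam j *: e j) :> L.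
Proof. exact: osc_bracket_basis. Qed.

Lemma osc_e0_central x : lie e0 x = 0.
Proof.
apply/ffunP => i; rewrite osc_bracketE !ffunE.
case: i => [| |j|j] //; last 2 first.
- by rewrite !osc_basisE /=; ring.
- by rewrite !osc_basisE /=; ring.
by rewrite big1 // => j _; rewrite !osc_basisE /=; ring.
Qed.

(** Bracketing with \check{e}_j and e_j reads off the coordinates along e_j and
    \check{e}_j.  The coordinate along e_{-1} is detected by any e_j, because
    its weight is nonzero; this is where n >= 1 matters. *)
Lemma osc_central_eq x :
  (0 < n)%N -> (forall y, lie x y = 0) -> x = x Idx0 *: e0.
Proof.
move=> n_gt0 xC.
have xM1 : x IdxM1 = 0.
  have := congr1 (fun z : L => z (IdxEc (Ordinal n_gt0)))
                 (xC (e (Ordinal n_gt0))).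
  rewrite !osc_coordE eqxx /= ffunE mulr0 subr0 mulr1 => /eqP.
  by rewrite mulf_eq0 (negPf (lam_neq0 _)) => /eqP.
have xE j : x (IdxE j) = 0.
  by rewrite -(osc_bracket_ec_e0coord x j).1 xC ffunE.
have xEc j : x (IdxEc j) = 0.
  by apply/eqP; rewrite -oppr_eq0 -(osc_bracket_e_e0coord x j).1 xC ffunE.
rewrite {1}[x]osc_expand xM1 scale0r add0r.
rewrite big1 => [|j _]; last by rewrite xE scale0r.
by rewrite big1 ?addr0 // => j _; rewrite xEc scale0r.
Qed.

(** * Half-derivations of the oscillator algebra *)

Hypotheses (two_neq0 : (2 : K) != 0) (three_neq0 : (3 : K) != 0).

Section OneHalfDerivation.
Variable D : {linear L -> L}.
Hypothesis hD : half_derivation D.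

Let D2 x y i : 2 * D (lie x y) i = lie (D x) y i + lie x (D y) i.
Proof. by rewrite -osc_scaleE half_derivation_double // osc_addE. Qed.

(** e_j and \check{e}_j are multiples of brackets with e_{-1}, and no bracket
    has a component along e_{-1}. *)
Lemma half_derivation_em1_coord j :
  (D (e j) IdxM1 = 0) * (D (ec j) IdxM1 = 0).
Proof.
split; apply: (mulfI (mulf_neq0 two_neq0 (lam_neq0 j))); rewrite mulr0.
  have := D2 em1 (ec j) IdxM1.
  rewrite osc_em1_bracket_ec linearN linearZ /= !osc_bracketE addr0 ffunE.
  by rewrite osc_scaleE mulrN => /eqP; rewrite oppr_eq0 mulrA => /eqP.
have := D2 em1 (e j) IdxM1.
by rewrite osc_em1_bracket_e linearZ /= !osc_bracketE addr0 osc_scaleE mulrA.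
Qed.

(** These are the coordinates along e_k and \check{e}_k of the half-derivation
    identity for the brackets [e_{-1}, e_j] and [e_{-1}, \check{e}_j]. *)
Lemma half_derivation_rotation j k :
  [/\ 2 * (lam j * D (ec j) (IdxE k)) = - (lam k * D (e j) (IdxEc k)),
      2 * (lam j * D (e j) (IdxEc k)) = - (lam k * D (ec j) (IdxE k)),
      2 * (lam j * D (ec j) (IdxEc k)) =
        lam k * D em1 IdxM1 * (k == j)%:R + lam k * D (e j) (IdxE k)
    & 2 * (lam j * D (e j) (IdxE k)) =
        lam k * D em1 IdxM1 * (k == j)%:R + lam k * D (ec j) (IdxEc k)].
Proof.
have He i := D2 em1 (e j) i.
have Hec i := D2 em1 (ec j) i.
have negE x i : (- x) i = - x i by rewrite ffunE.
split.
- have := He (IdxE k); rewrite osc_em1_bracket_e linearZ osc_scaleE => ->.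
  by rewrite osc_bracket_em1_coord !osc_coordE /=; ring.
- apply: oppr_inj.
  have := Hec (IdxEc k); rewrite osc_em1_bracket_ec linearN linearZ negE.
  rewrite osc_scaleE mulrN => ->.
  by rewrite osc_bracket_em1_coord !osc_coordE /=; ring.
- have := He (IdxEc k); rewrite osc_em1_bracket_e linearZ osc_scaleE => ->.
  by rewrite osc_bracket_em1_coord !osc_coordE /=; ring.
- apply: oppr_inj.
  have := Hec (IdxE k); rewrite osc_em1_bracket_ec linearN linearZ negE.
  rewrite osc_scaleE mulrN => ->.
  by rewrite osc_bracket_em1_coord !osc_coordE /=; ring.
Qed.

(** The component along e_0 of the half-derivation identity for the vanishing
    brackets [e_j, e_k], [\check{e}_j, \check{e}_k] and [e_j, \check{e}_k]. *)
Lemma half_derivation_commutation j k : j != k ->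
  [/\ D (e j) (IdxEc k) = D (e k) (IdxEc j),
      D (ec j) (IdxE k) = D (ec k) (IdxE j)
    & D (e j) (IdxE k) = - D (ec k) (IdxEc j)].
Proof.
move=> jk.
have H (i i' : osc_index n) : osc_table lam i i' = 0 ->
    lie (D (osc_basis lam i)) (osc_basis lam i') Idx0
    = - lie (osc_basis lam i) (D (osc_basis lam i')) Idx0.
  rewrite -osc_bracket_basis => ii'.
  have := D2 (osc_basis lam i) (osc_basis lam i') Idx0.
  by rewrite ii' linear0 ffunE mulr0 => /esym/eqP; rewrite addr_eq0 => /eqP.
split.
- have := H (IdxE j) (IdxE k) erefl.
  by rewrite !osc_bracket_e_e0coord => /oppr_inj.
- have := H (IdxEc j) (IdxEc k) erefl.
  by rewrite !osc_bracket_ec_e0coord opprK.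
have := H (IdxE j) (IdxEc k); rewrite /= (negPf jk) => /(_ erefl).
by rewrite osc_bracket_e_e0coord osc_bracket_ec_e0coord.
Qed.

(** Off the diagonal, the first equation is a rotation relation for (j, k) and
    the second one a relation for (k, j), transported to (j, k) by commutation:
    the factor 2 sits on u in one and on v in the other, so that no resonance
    between u and v can occur.  On the diagonal u = v. *)
Lemma rotation_pair_eq0 (u v s t : K) : u != 0 -> v != 0 ->
  2 * (u * s) = v * t -> 2 * (v * t) = u * s -> s = 0 /\ t = 0.
Proof.
move=> u0 v0 st ts.
have us0 : u * s = 0.
  apply: (mulfI three_neq0); rewrite mulr0.
  (* Substituting one equation into the other gives 4 us = us. *)
  have -> : 3 * (u * s) = 2 * (2 * (u * s)) - u * s by ring.
  by rewrite st ts subrr.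
have vt0 : v * t = 0 by rewrite -st us0 mulr0.
by split; apply/eqP; [move/eqP: us0|move/eqP: vt0];
   rewrite mulf_eq0 ?(negPf u0) ?(negPf v0).
Qed.

Lemma half_derivation_offdiag j k : k != j ->
  [/\ D (e j) (IdxE k) = 0, D (e j) (IdxEc k) = 0,
      D (ec j) (IdxE k) = 0 & D (ec j) (IdxEc k) = 0].
Proof.
move=> kj; have jk : j != k by rewrite eq_sym.
have [rq _ sp _] := half_derivation_rotation j k.
have [_ qr' sp' _] := half_derivation_rotation k j.
have [qq rr ps] := half_derivation_commutation kj.
have [_ _ ps'] := half_derivation_commutation jk.
move: sp sp' qr'; rewrite (negPf kj) (negPf jk) !mulr0 !add0r => sp sp' qr'.
have [s0 p0] : D (ec j) (IdxEc k) = 0 /\ D (e j) (IdxE k) = 0.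
  apply: (rotation_pair_eq0 (u := lam j) (v := lam k)) => //.
  by apply: oppr_inj; rewrite ps' mulrN mulrN opprK sp' ps mulrN.
have [r0 /eqP] : D (ec j) (IdxE k) = 0 /\ - D (e j) (IdxEc k) = 0.
  apply: (rotation_pair_eq0 (u := lam j) (v := lam k)); rewrite ?mulrN //.
  by rewrite -qq qr' rr opprK.
by rewrite oppr_eq0 => /eqP.
Qed.

Lemma half_derivation_diag j :
  [/\ D (e j) (IdxE j) = D em1 IdxM1, D (e j) (IdxEc j) = 0,
      D (ec j) (IdxE j) = 0 & D (ec j) (IdxEc j) = D em1 IdxM1].
Proof.
have [rq qr sp ps] := half_derivation_rotation j j.
move: sp ps; rewrite eqxx mulr1 => sp ps.
have [r0 /eqP] : D (ec j) (IdxE j) = 0 /\ - D (e j) (IdxEc j) = 0.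
  apply: (rotation_pair_eq0 (u := lam j) (v := lam j)); rewrite ?mulrN //.
  by rewrite qr opprK.
rewrite oppr_eq0 => /eqP q0.
(* Subtracting alpha turns the two inhomogeneous relations into a pair. *)
have [/eqP] : D (ec j) (IdxEc j) - D em1 IdxM1 = 0
            /\ D (e j) (IdxE j) - D em1 IdxM1 = 0.
  apply: (rotation_pair_eq0 (u := lam j) (v := lam j)) => //.
    by rewrite !mulrBr sp; ring.
  by rewrite !mulrBr ps; ring.
by rewrite subr_eq0 => /eqP s /eqP; rewrite subr_eq0 => /eqP.
Qed.

(** The scalar depends on D only, not on x: this uniformity is what makes a
    single test vector sufficient for local half-derivations. *)
Lemma half_derivation_scalar x (i : osc_index n) :
    (0 < n)%N -> x IdxM1 = 0 -> i != Idx0 ->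
  D x i = D em1 IdxM1 * x i.
Proof.
move=> n_gt0 xM1 i0.
have De0 : D e0 i = 0.
  rewrite (osc_central_eq (x := D e0) n_gt0).
    by rewrite osc_scaleE osc_basisE (negPf i0) mulr0.
  exact: half_derivation_center osc_e0_central.
rewrite {1}[x]osc_expand xM1 scale0r add0r !linearD !linear_sum /= linearZ.
rewrite !osc_addE !osc_sum_coordE osc_scaleE De0 mulr0 add0r.
under eq_bigr do rewrite linearZ osc_scaleE.
under [X in _ + X]eq_bigr do rewrite linearZ osc_scaleE.
have off (F G : 'I_n -> K) k : (forall j, j != k -> G j = 0) ->
    \sum_j F j * G j = F k * G k.
  move=> G0; rewrite (bigD1 k) //= big1 ?addr0 // => j /G0 ->.
  exact: mulr0.
case: i i0 {De0} => // [_|k _|k _].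
- rewrite xM1 mulr0 !big1 ?addr0 // => j _;
    by rewrite half_derivation_em1_coord mulr0.
- have [p0 _ r0 _] := half_derivation_diag k.
  rewrite !(off _ _ k) ?p0 ?r0 ?mulr0 ?addr0 1?mulrC // => j jk;
    by move: jk; rewrite eq_sym => /half_derivation_offdiag[].
- have [_ q0 _ s0] := half_derivation_diag k.
  rewrite !(off _ _ k) ?q0 ?s0 ?mulr0 ?add0r 1?mulrC // => j jk;
    by move: jk; rewrite eq_sym => /half_derivation_offdiag[].
Qed.

End OneHalfDerivation.

(** * Local half-derivations of the oscillator algebra *)

Section LocalHalfDerivation.
Variable Delta : {linear L -> L}.
Hypotheses (n_gt0 : (0 < n)%N) (Delta_local : local_half_derivation Delta).

Lemma local_half_derivation_e0 :
  Delta e0 = Delta e0 Idx0 *: e0.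
Proof.
apply: osc_central_eq => //; have [D hD ->] := Delta_local e0.
exact: half_derivation_center osc_e0_central.
Qed.

Lemma local_half_derivation_scalar x : x IdxM1 = 0 ->
  exists b : K, forall i, i != Idx0 -> Delta x i = b * x i.
Proof.
move=> xM1; have [D hD ->] := Delta_local x.
by exists (D em1 IdxM1) => i i0; apply: half_derivation_scalar.
Qed.

Lemma local_half_derivation_basis : exists b : K,
  forall i : osc_index n, i != IdxM1 -> i != Idx0 ->
    Delta (osc_basis lam i)
    = Delta (osc_basis lam i) Idx0 *: e0 + b *: osc_basis lam i.
Proof.
pose inner (i : osc_index n) := (i != IdxM1) && (i != Idx0).
pose v : L := \sum_(i | inner i) osc_basis lam i.
have vE i : inner i -> v i = 1.
  move=> ii; rewrite sum_ffunE (bigD1 i) //= osc_basisE eqxx big1 ?addr0 //.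
  by move=> i' /andP[_ /negPf i'i]; rewrite osc_basisE eq_sym i'i.
have vM1 : v IdxM1 = 0.
  rewrite sum_ffunE big1 // => i /andP[/negPf iM1 _].
  by rewrite osc_basisE eq_sym iM1.
have [b vb] := local_half_derivation_scalar vM1; exists b => i iM1 i0.
have scalar i' : inner i' -> exists bi : K,
    forall k : osc_index n, k != Idx0 ->
    Delta (osc_basis lam i') k = bi * (k == i')%:R.
  move=> /andP[/negPf i'M1 _].
  have [|bi Hbi] := @local_half_derivation_scalar (osc_basis lam i').
    by rewrite osc_basisE eq_sym i'M1.
  by exists bi => k k0; rewrite Hbi // osc_basisE.
have inner_i : inner i by rewrite /inner iM1.
have [bi Hbi] := scalar i inner_i.
(* Only Delta of the i-th basis vector contributes to coordinate i of
   Delta v, whose value is b. *)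
have bib : bi = b.
  have := vb i i0; rewrite vE // mulr1 linear_sum sum_ffunE (bigD1 i) //=.
  rewrite Hbi // eqxx mulr1 big1 ?addr0 // => i' /andP[ii' /negPf i'i].
  by have [c ->] := scalar i' ii'; rewrite // eq_sym i'i mulr0.
apply/ffunP => k; rewrite osc_addE !osc_scaleE !osc_basisE.
have [->|k0] := eqVneq k Idx0.
  by rewrite eq_sym (negPf i0) mulr0 mulr1 addr0.
by rewrite mulr0 add0r -bib; exact: Hbi.
Qed.

End LocalHalfDerivation.

End Oscillator.

Unset Implicit Arguments.
Set Strict Implicit.

Theorem theorem19 (R : realType) (n : nat) (lam : 'I_n -> R)
    (n_ge1 : (1 <= n)%N)
    (lam_gt0 : forall j : 'I_n, 0 < lam j)
    (lam_le : forall i j : 'I_n, (i <= j)%N -> lam i <= lam j)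
    (Delta : {linear oscillator (fun j => (lam j)%:C) ->
                     oscillator (fun j => (lam j)%:C)})
    (Delta_local : local_half_derivation Delta) :
  exists (dm1 d0 : R[i]) (d : 'I_(n + n) -> R[i])
         (a0 : R[i]) (a c : 'I_n -> R[i]) (b : R[i]),
    [/\ Delta osc_em1 =
          dm1 *: osc_em1 + d0 *: osc_e0
          + \sum_(j < n) d (lshift n j) *: osc_e j
          + \sum_(j < n) d (rshift n j) *: osc_ec j,
        Delta osc_e0 = a0 *: osc_e0,
        forall i : 'I_n, Delta (osc_e i) = a i *: osc_e0 + b *: osc_e i
      & forall i : 'I_n, Delta (osc_ec i) = c i *: osc_e0 + b *: osc_ec i].
Proof.
have lamC_neq0 j : (lam j)%:C != 0.
  by rewrite -(rmorph0 (real_complex R)) (inj_eq (fmorph_inj _)) gt_eqF.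
have two_neq0 : (2 : R[i]) != 0 by rewrite pnatr_eq0.
have three_neq0 : (3 : R[i]) != 0 by rewrite pnatr_eq0.
have [b Hb] := local_half_derivation_basis lamC_neq0 two_neq0 three_neq0
                 n_ge1 Delta_local.
pose d (s : 'I_(n + n)) := Delta osc_em1
  match split s with inl j => IdxE j | inr j => IdxEc j end.
exists (Delta osc_em1 IdxM1), (Delta osc_em1 Idx0), d, (Delta osc_e0 Idx0).
exists (fun j => Delta (osc_e j) Idx0), (fun j => Delta (osc_ec j) Idx0), b.
split=> [||i|i]; [|exact: local_half_derivation_e0 |exact: Hb|exact: Hb].
rewrite {1}[Delta osc_em1]osc_expand; congr (_ + _ + _ + _);
  apply: eq_bigr => j _; rewrite /d.
  by rewrite (unsplitK (inl j)).
by rewrite (unsplitK (inr j)).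
Qed.
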